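(* Let $p\ge1$. Let $(V,\mu)$ and $(E,\tau)$ be positive measure spaces, $M:V\times E\to\mathbb{R}$ a $(\mu\times\tau)$-measurable function, and $wt:E\to\mathbb{R}$ a $\tau$-measurable function. Suppose that: (i) $0<\mu(V)<\infty$; (ii) $0<s:=\int_E wt\,d\tau<\infty$; (iii) $\int_{V\times E}|M(v,e)|\,|wt(e)|\,d(\mu\times\tau)<\infty$; (iv) for some real number $c$, $\int_V M(v,e)\,d\mu(v)=c$ for $\tau$-almost all $e\in E$; (v) $\delta(v):=\int_E M(v,e)\,wt(e)\,d\tau(e)\ge0$ for $\mu$-almost all $v\in V$; (vi) $\int_{V\times E}\delta(v)^{p-1}\,|M(v,e)|\,|wt(e)|\,d(\mu\times\tau)<\infty$. Let $\bar\delta=\frac{1}{\mu(V)}\int_V\delta\,d\mu$. Then $$\frac1s\int_{V\times E}\delta(v)^{p-1}\,M(v,e)\,wt(e)\,d(\mu\times\tau)=\frac1s\int_V\delta(v)^p\,d\mu(v)\;\ge\;c\,\bar\delta^{\,p-1}.$$ In particular, $$\left(\frac{1}{\mu(V)}\int_V\delta(v)^p\,d\mu(v)\right)^{1/p}\ge\frac{1}{\mu(V)}\int_V\delta(v)\,d\mu(v).$$ Moreover, if $p>1$, then equality holds in the last inequality if and only if $\delta(v)=\bar\delta$ for $\mu$-a.e. $v\in V$.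
   Context: $\mu\times\tau$ denotes the product measure on $V\times E$. For $p=1$ the expression $t^{p-1}$ is the constant function $1$ (so $0^0=1$). *)

(* Defs.v *)
From HB Require Import structures.
From mathcomp Require Export all_boot all_order all_algebra.
From mathcomp Require Export all_classical all_reals all_analysis.
Export Order.TTheory GRing.Theory Num.Theory.
Export numFieldNormedType.Exports.

Set Implicit Arguments.
Unset Strict Implicit.
Unset Printing Implicit Defensive.

Local Open Scope ring_scope.
Local Open Scope classical_set_scope.
Local Open Scope ereal_scope.

(* The measure spaces are arbitrary, in particular not assumed sigma-finite,
   so the product measure is taken to be any measure on the product
   sigma-algebra with the defining values on rectangles (0 * +oo = 0).  It is
   unique when both factors are sigma-finite ([product_measure_unique]), and
   exists as soon as the first factor is, see below. *)
Definition is_product_measure (R : realType) (dV dE : measure_display)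
    (V : measurableType dV) (E : measurableType dE)
    (mu : {measure set V -> \bar R}) (tau : {measure set E -> \bar R})
    (mutau : {measure set (V * E)%type -> \bar R}) : Prop :=
  forall (A : set V) (B : set E), measurable A -> measurable B ->
    mutau (A `*` B) = mu A * tau B.

Lemma is_product_measure2 (R : realType) (dV dE : measure_display)
    (V : measurableType dV) (E : measurableType dE)
    (mu : {sigma_finite_measure set V -> \bar R})
    (tau : {measure set E -> \bar R}) :
  is_product_measure mu tau (mu \x^ tau).
Proof. by move=> A B mA mB; exact: product_measure2E. Qed.

(* The integral is \bar R-valued: no truncation where it is infinite. *)
Definition delta (R : realType) (dV dE : measure_display)
    (V : measurableType dV) (E : measurableType dE)
    (tau : {measure set E -> \bar R}) (M : V * E -> R) (wt : E -> R)
    (v : V) : \bar R :=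
  \int[tau]_e (M (v, e) * wt e)%:E.

Definition average (R : realType) (dV : measure_display)
    (V : measurableType dV) (mu : {measure set V -> \bar R})
    (f : V -> \bar R) : \bar R :=
  (mu setT)^-1 * \int[mu]_v f v.

(* Main.v *)
(* The function M * wt vanishes outside V x D with D = {wt != 0}. Since wt is
   integrable, the restriction of tau to D is sigma-finite, so the product
   measure is unique on V x D and Fubini's theorem applies there. It yields
   both the first equality and, integrating over V first, that the integral of
   delta is c * s, i.e. c * s = mu(V) * dbar. The inequalities then reduce to
   mu(V) * dbar^p <= \int delta^p, obtained by integrating the tangent
   inequality dbar^p + p dbar^(p-1) (t - dbar) <= t^p at t = delta(v). For
   p > 1 it is strict unless t = dbar, which gives the equality case. *)
From HB Require Import structures.
Require Import Defs.
From mathcomp Require Import measurable_realfun ring lra.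

Set Implicit Arguments.
Unset Strict Implicit.
Unset Printing Implicit Defensive.

Local Open Scope ring_scope.
Local Open Scope classical_set_scope.
Local Open Scope ereal_scope.

(** * Tangent inequality for real powers *)

Section powR_tangent.
Local Open Scope ring_scope.
Context {R : realType}.
Implicit Types p a t : R.

Lemma powR_gt_tangent p a t : 1 < p -> 0 <= a -> 0 <= t -> t != a ->
  a `^ p + p * a `^ (p - 1) * (t - a) < t `^ p.
Proof.
move=> p1 a0 t0 ta.
have p0 : 0 < p by lra.
have pN0 : p != 0 by lra.
have p1N0 : p - 1 != 0 by lra.
rewrite -(mulr_powRB1 a0 p0) -(mulr_powRB1 t0 p0).
have [aE|aN0] := eqVneq a 0.
  rewrite aE powR0// !(mul0r, mulr0, addr0).
  have {}t0 : 0 < t by rewrite lt_neqAle t0 andbT eq_sym -aE.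
  by rewrite mulr_gt0 ?powR_gt0.
have {aN0}a0 : 0 < a by rewrite lt_neqAle a0 andbT eq_sym.
have Ap : 0 < a `^ (p - 1) by exact: powR_gt0.
have [->|tN0] := eqVneq t 0.
  rewrite mul0r; have : 0 < a `^ (p - 1) * (a * (p - 1)).
    by rewrite !mulr_gt0//; lra.
  by lra.
have {tN0}t0 : 0 < t by rewrite lt_neqAle t0 andbT eq_sym.
have at0 : 0 < a / t by rewrite divr_gt0.
(* Write t^(p-1) = a^(p-1) exp((p-1) ln(t/a)) and use exp y >= 1 + y twice, the
   second time strictly: exp((p-1) ln(t/a)) >= 1 + (p-1) ln(t/a) and
   a/t > 1 + ln(a/t). *)
have lnat : ln (a / t) != 0.
  rewrite ln_eq0//; apply: contra ta => /eqP at1.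
  by rewrite -[a](divfK (lt0r_neq0 t0)) at1 mul1r.
have /expR_gt1Dx := lnat; rewrite lnK ?posrE// => lt_ln.
have -> : t `^ (p - 1) = a `^ (p - 1) * (t / a) `^ (p - 1).
  rewrite -powRM ?divr_ge0 ?ltW//; congr (_ `^ _); field; lra.
have -> : t / a = (a / t)^-1 by field; lra.
rewrite [(a / t)^-1 `^ _]/powR gt_eqF ?invr_gt0// lnV ?posrE//.
set l := ln _ in lt_ln *.
have : 1 + (p - 1) * - l <= expR ((p - 1) * - l) by exact: expR_ge1Dx.
have : (p - 1) * (1 - a / t) < (p - 1) * - l by rewrite ltr_pM2l; lra.
move=> h1 h2.
(* The left side is t + (p-1)(t-a) = a + p(t-a), so multiplying by a^(p-1) turns it into the tangent
   at a. *)
have h : t * (1 + (p - 1) * (1 - a / t)) < t * expR ((p - 1) * - l).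
  by rewrite ltr_pM2l//; lra.
rewrite -(ltr_pM2l Ap) in h.
apply: le_lt_trans (lt_le_trans h _); last by rewrite mulrCA.
rewrite le_eqVlt; apply/orP; left; apply/eqP; field; lra.
Qed.

Lemma powR_ge_tangent p a t : 1 <= p -> 0 <= a -> 0 <= t ->
  a `^ p + p * a `^ (p - 1) * (t - a) <= t `^ p.
Proof.
rewrite le_eqVlt => /predU1P[<- a0 t0|p1 a0 t0].
  (* For p = 1 the slope is a^0 = 1, also at a = 0, and the tangent is t itself. *)
  by rewrite subrr powRr0 !powRr1//; lra.
have [->|ta] := eqVneq t a; first by rewrite subrr mulr0 addr0.
exact/ltW/powR_gt_tangent.
Qed.

End powR_tangent.

(** * Bundled measures and integrability *)

Section measure_structures.
Context d (T : measurableType d) (R : realType).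
Variable mu : {measure set T -> \bar R}.

(** Fubini's theorem and uniqueness of product measures are stated for bundled structures; an
    equality of measures allows substitution into them. *)
Lemma sigma_finite_measure_ex : sigma_finite setT mu ->
  exists nu : {sigma_finite_measure set T -> \bar R}, mu = nu.
Proof.
move=> sigma_mu.
pose H1 := isSFinite.Build _ _ _ _ (sfinite_measure_sigma_finite sigma_mu).
pose H2 := isSigmaFinite.Build _ _ _ _ sigma_mu.
pose nu := HB.pack_for (SigmaFiniteMeasure.type T R) (Measure.sort mu) H1 H2.
by exists nu; exact: eq_measure.
Qed.

Lemma finite_measure_ex : mu setT < +oo ->
  exists nu : {finite_measure set T -> \bar R}, mu = nu.
Proof.
move=> /lty_fin_num_fun fin_mu.
have sigma_mu : sigma_finite setT mu.
  by apply: fin_num_fun_sigma_finite; rewrite ?measure0.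
have [nu nuE] := sigma_finite_measure_ex sigma_mu.
rewrite nuE in fin_mu *.
pose H := isFinite.Build _ _ _ _ fin_mu.
pose nu' := HB.pack_for (FiniteMeasure.type T R) (SigmaFiniteMeasure.sort nu) H.
by exists nu'; exact: eq_measure.
Qed.

End measure_structures.

(** In [\bar R], +oo - +oo is -oo, so a finite difference of the integrals of [f^\+] and [f^\-]
    forces both to be finite. This turns (ii), a condition on a signed integral, into integrability
    of [wt]. *)
Lemma fin_num_integral_integrable d (T : measurableType d) (R : realType)
    (mu : {measure set T -> \bar R}) (f : T -> \bar R) :
  measurable_fun setT f -> \int[mu]_x f x \is a fin_num ->
  mu.-integrable setT f.
Proof.
move=> mf; rewrite integralE => fin_f; apply/integrableP; split => //.
rewrite -/(abse \o f) fune_abse ge0_integralD//.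
- have : 0 <= \int[mu]_x f^\+ x by exact: integral_ge0.
  have : 0 <= \int[mu]_x f^\- x by exact: integral_ge0.
  by move: fin_f; case: (\int[mu]_x f^\+ x) => [r| |];
    case: (\int[mu]_x f^\- x) => [r'| |] // *; rewrite -EFinD ltry.
- exact: measurable_funepos.
- exact: measurable_funeneg.
Qed.

(** * Restriction of a measure to the support of a function *)

Section restriction.
Context d (T : measurableType d) (R : realType).
Variable mu : {measure set T -> \bar R}.

Lemma integral_mrestr_support (D : set T) (mD : measurable D)
    (f : T -> \bar R) : (forall x, ~ D x -> f x = 0) ->
  \int[mrestr mu mD]_x f x = \int[mu]_x f x.
Proof.
move=> f0; have fD : f = f \_ D.
  by apply/funext => x; rewrite patchE; case: ifPn => // xD;
    rewrite f0// => Dx; rewrite mem_set in xD.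
rewrite fD -!integral_mkcond; apply: eq_measure_integral => A mA AD.
by rewrite /= /mrestr setIidl.
Qed.

Lemma ae_mrestr (D : set T) (mD : measurable D) (P : T -> Prop) :
  {ae mu, forall x, P x} -> {ae mrestr mu mD, forall x, P x}.
Proof.
move=> [N [mN N0 PN]]; exists N; split => //; apply/eqP; rewrite eq_le.
rewrite measure_ge0 andbT /= /mrestr -N0.
by rewrite le_measure ?inE//; exact: measurableI.
Qed.

(** By Markov's inequality each set where |f| is at least 1/(n+1) has finite measure. These sets
    cover the support, and its complement, null for the restriction, can be added to each. *)
Lemma sigma_finite_support (f : T -> R) :
  mu.-integrable setT (EFin \o f) ->
  forall mD : measurable [set x | f x != 0%R], sigma_finite setT (mrestr mu mD).
Proof.
move=> /integrableP[mf foo] mD; set D := [set x | _] in mD *.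
pose A n := [set x | n.+1%:R^-1%:E <= `|(EFin \o f) x| ].
have mA n : measurable (A n).
  by rewrite -[A n]setTI; apply: emeasurable_fun_c_infty => //;
    exact: measurableT_comp.
exists (fun n => A n `|` ~` D).
  apply/esym; rewrite -subTset => x _.
  have [fx0|fx0] := eqVneq (f x) 0%R.
    by exists 0%N => //; right; rewrite /D /= fx0 eqxx.
  (* For this n, 1/|f x| < n+1. *)
  exists (Num.truncn `|f x|^-1) => //; left; rewrite /A /= lee_fin.
  rewrite invf_ple ?posrE ?normr_gt0 ?ltr0n//.
  by rewrite ltW// truncnS_gt.
move=> n; split; first by apply: measurableU => //; exact: measurableC.
apply: (@le_lt_trans _ _ (mu (A n))).
  rewrite /mrestr le_measure ?inE//.
    by apply: measurableI => //; apply: measurableU => //; exact: measurableC.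
  by move=> x [[]].
have n0 : (0 < n.+1%:R^-1 :> R)%R by rewrite invr_gt0.
have := le_integral_abse mu measurableT mf n0; rewrite setTI -/(A n).
move=> /le_lt_trans /(_ foo) h.
rewrite ltey; apply/eqP => An.
by move: h; rewrite An gt0_muley ?lte_fin// ltxx.
Qed.

End restriction.

(** * Power mean inequality and its equality case *)

Section power_mean.
Context d (T : measurableType d) (R : realType).
Variables (mu : {finite_measure set T -> \bar R}) (p a : R) (f : T -> R).
Hypotheses (p1 : (1 <= p)%R) (a0 : (0 <= a)%R) (f0 : forall x, (0 <= f x)%R).
Hypotheses (intf : mu.-integrable setT (EFin \o f))
  (intfp : mu.-integrable setT (fun x => (f x `^ p)%:E))
  (mean_f : \int[mu]_x (f x)%:E = a%:E * mu setT).

Let gap x := (f x `^ p - (a `^ p + p * a `^ (p - 1) * (f x - a)))%R.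

Let gap_ge0 x : (0 <= gap x)%R.
Proof. by rewrite subr_ge0 powR_ge_tangent. Qed.

Let mgap : measurable_fun setT gap.
Proof.
have mf : measurable_fun setT f by exact/measurable_EFinP/measurable_int/intf.
have mfp : measurable_fun setT (fun x => f x `^ p)%R.
  exact/measurable_EFinP/measurable_int/intfp.
apply: measurable_funB => //; apply: measurable_funD => //.
by apply: measurable_funM => //; exact: measurable_funB.
Qed.

Let integral_gap :
  \int[mu]_x (gap x)%:E = \int[mu]_x (f x `^ p)%:E - (a `^ p)%:E * mu setT.
Proof.
(* The tangent at [a] is k x + b. Since [f] has mean [a], the integral of k f + b is a^p times the
   total mass. *)
pose k := (p * a `^ (p - 1))%R; pose b := (a `^ p - k * a)%R.
have gapE x : (gap x)%:E = (f x `^ p)%:E - (k%:E * (f x)%:E + b%:E).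
  transitivity (f x `^ p - (k * f x + b))%:E => //.
  by congr EFin; rewrite /gap /b /k; ring.
under eq_integral do rewrite gapE.
have intkf : mu.-integrable setT (fun x => k%:E * (f x)%:E).
  exact: integrableZl.
have intb : mu.-integrable setT (fun=> b%:E).
  exact: finite_measure_integrable_cst.
rewrite integralB//; last exact: integrableD.
have intbE : \int[mu]_x b%:E = b%:E * mu setT by exact: integral_cst.
rewrite integralD// integralZl// intbE mean_f.
have : mu setT \is a fin_num by exact: fin_num_measure.
case: (mu setT) => // m _; congr (_ - _).
by rewrite -!EFinM -EFinD; congr EFin; rewrite /b /k; ring.
Qed.

Lemma le_power_mean : (a `^ p)%:E * mu setT <= \int[mu]_x (f x `^ p)%:E.
Proof.
rewrite -sube_ge0; last by rewrite fin_numM// fin_num_measure.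
by rewrite -integral_gap integral_ge0// => x _; rewrite lee_fin.
Qed.

(** Equality makes the integral of the nonnegative [gap] zero, so [gap] vanishes almost everywhere,
    which the strict tangent inequality allows only where f = a. *)
Lemma power_mean_eq : (1 < p)%R ->
  (a `^ p)%:E * mu setT = \int[mu]_x (f x `^ p)%:E ->
  {ae mu, forall x, f x = a}.
Proof.
move=> p_gt1 eq_mean.
have gap0 : \int[mu]_x `|(gap x)%:E| = 0.
  under eq_integral do rewrite gee0_abs ?lee_fin//.
  by rewrite integral_gap -eq_mean subee// fin_numM// fin_num_measure.
have := (ae_eq_integral_abs mu measurableT _).1 gap0.
have mgapE : measurable_fun setT (EFin \o gap) by exact/measurable_EFinP.
move=> /(_ mgapE); apply: filterS => x /(_ I) [] gapx0.
apply: contra_eq gapx0 => fxa; rewrite subr_eq0 gt_eqF//.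
exact: powR_gt_tangent.
Qed.

End power_mean.

(** * Uniqueness of the product measure and weighted Fubini *)

Section product_measure_fubini.
Context dV dE (V : measurableType dV) (E : measurableType dE) (R : realType).
Variable mu : {sigma_finite_measure set V -> \bar R}.

(** On rectangles, the restriction of [mutau] to V x D takes the product values of [mu] and [tauD].
    Both factors are sigma-finite, so it is their product measure. *)
Lemma integral_product_support (tau : {measure set E -> \bar R})
    (mutau : {measure set (V * E)%type -> \bar R})
    (D : set E) (mD : measurable D)
    (tauD : {sigma_finite_measure set E -> \bar R}) (f : V * E -> \bar R) :
  is_product_measure mu tau mutau ->
  (forall A, tauD A = mrestr tau mD A) ->
  (forall z, ~ D z.2 -> f z = 0) ->
  \int[mutau]_z f z = \int[mu \x tauD]_z f z.
Proof.
move=> mutauE tauDE f0.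
have mTD : measurable (setT `*` D : set (V * E)) by exact: measurableX.
rewrite -(integral_mrestr_support _ mTD); last first.
  by move=> z zD; apply: f0 => zD2; exact: zD.
apply: eq_measure_integral => A mA _; apply/esym.
apply: product_measure_unique => // B C mB mC.
rewrite /= /mrestr -setXI setIT mutauE//; last exact: measurableI.
by rewrite tauDE.
Qed.

Variable tau : {sigma_finite_measure set E -> \bar R}.

(** For almost every v, [h v] is finite and the section of [G] is integrable, so the weight leaves
    the inner integral by linearity. *)
Lemma fubini_weight (h : V -> \bar R) (G : V * E -> \bar R) :
  (mu \x tau).-integrable setT G ->
  (mu \x tau).-integrable setT (fun z => h z.1 * G z) ->
  measurable_fun setT h -> {ae mu, forall v, h v \is a fin_num} ->
  \int[mu \x tau]_z (h z.1 * G z) = \int[mu]_v (h v * \int[tau]_e G (v, e)).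
Proof.
move=> intG inthG mh finh.
rewrite -(integral12_prod_meas1 inthG); apply: ae_eq_integral => //.
- exact: (measurable_fubini_F inthG).
- by apply: emeasurable_funM => //; exact: (measurable_fubini_F intG).
move: finh (ae_integrable1 intG); apply: filterS2 => v hv intGv _.
rewrite /fubini_F /=; case: (h v) hv => // r _.
by rewrite integralZl.
Qed.

End product_measure_fubini.

(** * The result for finite mu and sigma-finite tau *)

Section sigma_finite_case.
Context (R : realType) (dV dE : measure_display).
Context (V : measurableType dV) (E : measurableType dE).
Variables (mu : {finite_measure set V -> \bar R})
  (tau : {sigma_finite_measure set E -> \bar R}).
Variables (p c : R) (M : V * E -> R) (wt : E -> R).
Hypotheses (p_ge1 : (1 <= p)%R) (mu_gt0 : 0 < mu setT)
  (intwt : tau.-integrable setT (EFin \o wt))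
  (s_gt0 : 0 < \int[tau]_e (wt e)%:E)
  (intMwt : (mu \x tau).-integrable setT (fun z => (M z * wt z.2)%:E))
  (margM : {ae tau, forall e, \int[mu]_v (M (v, e))%:E = c%:E})
  (delta_ge0 : {ae mu, forall v, 0 <= delta tau M wt v})
  (intdMwt : (mu \x tau).-integrable setT
    (fun z => (delta tau M wt z.1) `^ (p - 1) * (M z * wt z.2)%:E)).

Let d := delta tau M wt.
Let s := \int[tau]_e (wt e)%:E.
Let dbar := average mu d.

Let p0 : (0 < p)%R.
Proof. exact: lt_le_trans ltr01 p_ge1. Qed.

Let intd : mu.-integrable setT d.
Proof. exact: (integrable_fubini_F intMwt). Qed.

Let md : measurable_fun setT d.
Proof. exact: measurable_int intd. Qed.

Let mpoweR_d (q : R) : measurable_fun setT (fun v => d v `^ q).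
Proof. exact: (measurableT_comp (measurable_poweR q) md). Qed.

Lemma integral_delta : \int[mu]_v d v = c%:E * s.
Proof.
rewrite /s -integralZl//.
transitivity (\int[mu \x tau]_z (M z * wt z.2)%:E).
  exact: (integral12_prod_meas1 intMwt).
rewrite -(integral21_prod_meas1 intMwt); apply: ae_eq_integral => //.
- exact: (measurable_fubini_G intMwt).
- by apply: emeasurable_funM => //; exact: measurable_int intwt.
move: margM (ae_integrable2 intMwt); apply: filterS2 => e ce intMe _.
(* Integrability is known for M wt only. Where wt e is nonzero, dividing by it makes the section of
   M integrable; elsewhere both sides are 0. *)
rewrite /fubini_G /=; have [wt0|wtN0] := eqVneq (wt e) 0%R.
  by rewrite wt0 mule0; apply: integral0_eq => v _; rewrite mulr0.
have intM : mu.-integrable setT (fun v => (M (v, e))%:E).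
  have := integrableZr measurableT (wt e)^-1 intMe.
  by apply: eq_integrable => // v _; rewrite /= -EFinM mulfK.
by rewrite -ce -integralZr//; apply: eq_integral => v _; rewrite EFinM.
Qed.

(* A finite nonnegative version of d, to avoid the values of poweR at negative
   or infinite arguments. *)
Let f v : R := `|fine (d v)|%R.

Let dE_ae : {ae mu, forall v, d v = (f v)%:E}.
Proof.
move: delta_ge0 (integrable_ae measurableT intd).
apply: filterS2 => v d0 /(_ I) df.
by rewrite /f ger0_norm ?fine_ge0// fineK.
Qed.

Let mf : measurable_fun setT f.
Proof. by apply: measurableT_comp => //; exact: measurableT_comp. Qed.

Let mfp : measurable_fun setT (fun v => (f v `^ p)%:E).
Proof.
apply/measurable_EFinP.
exact: (@measurableT_comp _ _ _ _ _ _ (@powR R ^~ p)).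
Qed.

Let integral_f : \int[mu]_v d v = \int[mu]_v (f v)%:E.
Proof.
apply: ae_eq_integral => //; first exact/measurable_EFinP.
by apply: filterS dE_ae => v ->.
Qed.

Let integral_fp : \int[mu]_v d v `^ p = \int[mu]_v (f v `^ p)%:E.
Proof.
by apply: ae_eq_integral => //; apply: filterS dE_ae => v ->.
Qed.

(** The weight depends on v alone, so the inner integral is d(v), and d^(p-1) d = d^p also at d = 0
    because p > 0. *)
Lemma integral_delta_poweR :
  \int[mu \x tau]_z ((d z.1) `^ (p - 1) * (M z * wt z.2)%:E)
  = \int[mu]_v (d v) `^ p.
Proof.
rewrite (@fubini_weight _ _ _ _ _ _ _ (fun v => d v `^ (p - 1))
  (fun z => (M z * wt z.2)%:E))//; last first.
  by apply: filterS dE_ae => v ->.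
rewrite integral_fp; apply: ae_eq_integral => //; first exact: emeasurable_funM.
apply: filterS dE_ae => v dv _; rewrite -/(delta tau M wt v) -/(d v) dv.
by rewrite poweR_EFin -EFinM mulrC mulr_powRB1 ?normr_ge0.
Qed.

Let intf : mu.-integrable setT (EFin \o f).
Proof.
apply: le_integrable intd => //; first exact/measurable_EFinP.
move=> v _; rewrite /f /=.
by case: (d v) => [r| |] //=; rewrite ?normr0 ?leey// lee_fin normr_id.
Qed.

Let intfp : mu.-integrable setT (fun v => (f v `^ p)%:E).
Proof.
apply/integrableP; split => //.
under eq_integral do rewrite gee0_abs ?lee_fin ?powR_ge0//.
(* Finiteness of the p-th moment comes from (vi) through the preceding identity. *)
rewrite -integral_fp -integral_delta_poweR.
exact: (integrable_lty measurableT intdMwt).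
Qed.

Lemma sigma_finite_case :
  [/\ s^-1 * \int[mu \x tau]_z ((d z.1) `^ (p - 1) * (M z * wt z.2)%:E)
        = s^-1 * \int[mu]_v (d v) `^ p,
      c%:E * dbar `^ (p - 1) <= s^-1 * \int[mu]_v (d v) `^ p,
      dbar <= (average mu (fun v => (d v) `^ p)) `^ p^-1
    & (1 < p)%R ->
      ((average mu (fun v => (d v) `^ p)) `^ p^-1 = dbar <->
       {ae mu, forall v, d v = dbar})].
Proof.
have mu_fin : mu setT \is a fin_num by exact: fin_num_measure.
pose m := fine (mu setT).
have muE : mu setT = m%:E by rewrite fineK.
have m0 : (0 < m)%R by rewrite -lte_fin -muE.
have mN0 : m != 0%R by rewrite gt_eqF.
have pN0 : p != 0%R by rewrite gt_eqF.
pose t := fine s.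
have sE : s = t%:E by rewrite fineK//; exact: integrable_fin_num.
have t0 : (0 < t)%R by rewrite -lte_fin -sE.
(* The mean of delta, by [integral_delta]. *)
pose a := (m^-1 * (c * t))%R.
have invmu : (mu setT)^-1 = (m^-1)%:E by rewrite muE inver gt_eqF.
have dbarE : dbar = a%:E.
  by rewrite /dbar /average integral_delta sE invmu.
have mean_f : \int[mu]_v (f v)%:E = a%:E * mu setT.
  by rewrite -integral_f integral_delta sE muE -!EFinM; congr EFin;
    rewrite /a; field.
(* The sign of c is not given; that of [a] follows from f >= 0. *)
have a0 : (0 <= a)%R.
  rewrite -(pmulr_lge0 _ m0) -lee_fin EFinM -muE -mean_f.
  by apply: integral_ge0 => v _; rewrite lee_fin normr_ge0.
have f0 v : (0 <= f v)%R by rewrite /f normr_ge0.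
have := le_power_mean p_ge1 a0 f0 intf intfp mean_f.
have := power_mean_eq p_ge1 a0 f0 intf intfp mean_f.
rewrite -integral_fp muE.
pose i := fine (\int[mu]_v d v `^ p).
have iE : \int[mu]_v d v `^ p = i%:E.
  by rewrite fineK// integral_fp; exact: integrable_fin_num.
have avgE : average mu (fun v => d v `^ p) = (m^-1 * i)%:E.
  by rewrite /average iE invmu.
rewrite iE avgE dbarE integral_delta_poweR iE sE inver gt_eqF// !poweR_EFin.
rewrite -!EFinM !lee_fin => eq_mean le_mean.
have apK : ((a `^ p) `^ p^-1 = a)%R by rewrite -powRrM mulfV ?powRr1.
have le_i : (a `^ p <= m^-1 * i)%R by rewrite mulrC ler_pdivlMr.
split => //.
(* As c t = m a, the quantity t c a^(p-1) equals m a^p. *)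
- rewrite ler_pdivlMl//; apply: le_trans le_mean.
  rewrite -(mulr_powRB1 a0 p0) le_eqVlt; apply/orP; left; apply/eqP.
  by rewrite /a; field.
- rewrite -[leLHS]apK ge0_ler_powR ?nnegrE ?powR_ge0 ?invr_ge0 ?(ltW p0)//.
  exact: le_trans (powR_ge0 _ _) le_i.
move=> p_gt1; split=> [[eq_a]|d_eq].
  have i0 : (0 <= m^-1 * i)%R by exact: le_trans (powR_ge0 _ _) le_i.
  have ai : (a `^ p * m = i)%R.
    by rewrite -eq_a -powRrM mulVf ?powRr1//; field.
  have {}eq_mean := eq_mean p_gt1 (congr1 EFin ai).
  by move: eq_mean dE_ae; apply: filterS2 => v <- ->.
congr EFin; rewrite -[RHS]apK; congr (_ `^ _)%R.
suff -> : i = (a `^ p * m)%R by field.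
apply: EFin_inj; rewrite -iE EFinM -muE -integral_cst//.
by apply: ae_eq_integral => //; apply: filterS d_eq => v ->.
Qed.

End sigma_finite_case.

(** * Arbitrary measure spaces, by restricting tau to the support of wt *)

Theorem corollary5p3 (R : realType) (dV dE : measure_display)
    (V : measurableType dV) (E : measurableType dE)
    (mu : {measure set V -> \bar R}) (tau : {measure set E -> \bar R})
    (mutau : {measure set (V * E)%type -> \bar R})
    (p c : R) (M : V * E -> R) (wt : E -> R)
    (p_ge1 : (1 <= p)%R)
    (product_mutau : is_product_measure mu tau mutau)
    (measurable_M : measurable_fun setT M)
    (measurable_wt : measurable_fun setT wt)
    (hyp_i : 0 < mu setT < +oo)
    (hyp_ii : 0 < \int[tau]_e (wt e)%:E < +oo)
    (hyp_iii : \int[mutau]_z (`|M z| * `|wt z.2|)%:E < +oo)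
    (hyp_iv : {ae tau, forall e, \int[mu]_v (M (v, e))%:E = c%:E})
    (hyp_v : {ae mu, forall v, 0 <= delta tau M wt v})
    (hyp_vi : \int[mutau]_z
       ((delta tau M wt z.1) `^ (p - 1) * (`|M z| * `|wt z.2|)%:E) < +oo) :
  let s := \int[tau]_e (wt e)%:E in
  let d := delta tau M wt in
  let dbar := average mu d in
  [/\ s^-1 * \int[mutau]_z ((d z.1) `^ (p - 1) * (M z * wt z.2)%:E)
        = s^-1 * \int[mu]_v (d v) `^ p,
      c%:E * dbar `^ (p - 1) <= s^-1 * \int[mu]_v (d v) `^ p,
      dbar <= (average mu (fun v => (d v) `^ p)) `^ p^-1
    & (1 < p)%R ->
      ((average mu (fun v => (d v) `^ p)) `^ p^-1 = dbar <->
       {ae mu, forall v, d v = dbar})].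
Proof.
have /andP[mu_gt0 mu_lty] := hyp_i; have /andP[s_gt0 s_lty] := hyp_ii.
have [nu nuE] := finite_measure_ex mu_lty; subst mu.
have intwt : tau.-integrable setT (EFin \o wt).
  apply: fin_num_integral_integrable; first exact/measurable_EFinP.
  by rewrite ge0_fin_numE// ltW.
pose D := [set e | wt e != 0%R].
have mD : measurable D.
  rewrite -[D]setTI.
  have mwt : measurable_fun setT (EFin \o wt) by exact/measurable_EFinP.
  rewrite (_ : D = [set e | (EFin \o wt) e != 0]); first exact: emeasurable_neq.
  by apply/funext => e.
have [tauD tauDmE] := sigma_finite_measure_ex (sigma_finite_support intwt mD).
have tauDE : mrestr tau mD = tauD :> (set E -> \bar R).
  exact: (congr1 (@Measure.sort _ _ _) tauDmE).
have off_D e : ~ D e -> wt e = 0%R by move=> /negP /negPn /eqP.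
have int_wt : \int[tau]_e (wt e)%:E = \int[tauD]_e (wt e)%:E.
  by rewrite -tauDE integral_mrestr_support// => e /off_D ->.
have deltaE : delta tau M wt = delta tauD M wt.
  apply/funext => v; rewrite /delta /= -tauDE.
  by rewrite integral_mrestr_support// => e /off_D ->; rewrite mulr0.
have prodE (f : V * E -> \bar R) : (forall z, ~ D z.2 -> f z = 0) ->
    \int[mutau]_z f z = \int[nu \x tauD]_z f z.
  move=> f0; apply: (integral_product_support product_mutau _ f0) => A.
  by rewrite -tauDE.
have mMwt : measurable_fun setT (fun z : V * E => (M z * wt z.2)%:E).
  apply/measurable_EFinP; apply: measurable_funM => //.
  exact: measurableT_comp.
have intMwt : (nu \x tauD).-integrable setT (fun z => (M z * wt z.2)%:E).
  apply/integrableP; split => //; move: hyp_iii; rewrite prodE.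
    by under [X in _ -> X < _]eq_integral do rewrite abse_EFin normrM.
  by move=> z /off_D ->; rewrite normr0 mulr0.
rewrite int_wt deltaE; move=> s d dbar.
have md : measurable_fun setT d.
  exact: measurable_int (integrable_fubini_F intMwt).
(* The power of delta may be infinite, but x * 0 = 0 for every x in [\bar R], so the integrand
   vanishes off D. *)
rewrite prodE; last by move=> z /off_D ->; rewrite mulr0 mule0.
apply: (@sigma_finite_case _ _ _ _ _ nu tauD) => //.
- apply: fin_num_integral_integrable; first exact/measurable_EFinP.
  by rewrite -int_wt ge0_fin_numE// ltW.
- by rewrite -int_wt.
- by rewrite -tauDE; exact: ae_mrestr.
- by rewrite -deltaE.
apply/integrableP; split.
  apply: emeasurable_funM => //.
  apply: (measurableT_comp (measurable_poweR (p - 1))).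
  exact: measurableT_comp.
move: hyp_vi; rewrite prodE deltaE.
  (* [poweR] is nonnegative at every argument, so the absolute value falls on M wt alone, although
     delta >= 0 holds only almost everywhere. *)
  under [X in _ -> X < _]eq_integral do
    rewrite abseM (gee0_abs (poweR_ge0 _ _)) abse_EFin normrM.
  by [].
by move=> z /off_D ->; rewrite normr0 mulr0 mule0.
Qed.
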